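(* Let $(M,\varphi,\xi,\eta,g)$ be a contact pseudo-metric manifold, and let $\tau$ be the $(1,1)$ tensor field determined by $g(\tau X,Y)=(\pounds_\xi g)(X,Y)$ for all $X,Y\in TM$. Then $\tau$ is a Codazzi tensor, i.e. $(\nabla_X\tau)Y=(\nabla_Y\tau)X$ for all $X,Y\in TM$, if and only if the curvature tensor $R$ satisfies $$R(\xi,X)Y=\varepsilon(\nabla_X\varphi)Y\qquad\text{for all }X,Y\in TM.$$
   Context: An almost contact pseudo-metric manifold $(M,\varphi,\xi,\eta,g)$ is a smooth connected manifold $M$ of dimension $2n+1$ with a $(1,1)$ tensor field $\varphi$, a vector field $\xi$, a $1$-form $\eta$ and a pseudo-Riemannian metric $g$ such that $\varphi^2=-I+\eta\otimes\xi$, $\eta(\xi)=1$, $\varphi\xi=0$, $\eta\circ\varphi=0$, and $g(\varphi X,\varphi Y)=g(X,Y)-\varepsilon\eta(X)\eta(Y)$ for all $X,Y$, where $\varepsilon=\pm1$ is a fixed sign; this condition is equivalent to $\eta(X)=\varepsilon g(X,\xi)$ together with $g(\varphi X,Y)=-g(X,\varphi Y)$, and so $g(\xi,\xi)=\varepsilon$. It is a contact pseudo-metric manifold if $d\eta=\Phi$, where $\Phi(X,Y)=g(X,\varphi Y)$ and $d\eta(X,Y)=\frac12\big(X\eta(Y)-Y\eta(X)-\eta([X,Y])\big)$. $\nabla$ is the Levi-Civita connection of $g$, $R(X,Y)=[\nabla_X,\nabla_Y]-\nabla_{[X,Y]}$, $\pounds$ is the Lie derivative, and $(\nabla_XA)Y=\nabla_X(AY)-A(\nabla_XY)$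 for a $(1,1)$ tensor $A$. *)

(* Defs.v *)
From HB Require Import structures.
From mathcomp Require Import all_boot all_order all_algebra.
From mathcomp Require Import ring.
From mathcomp Require Import all_classical all_reals all_analysis.

Set Implicit Arguments.
Unset Strict Implicit.
Unset Printing Implicit Defensive.

Import Order.TTheory GRing.Theory Num.Theory.
Import numFieldNormedType.Exports.

Local Open Scope classical_set_scope.
Local Open Scope ring_scope.

(* Only the values of [f] on the open set [U] matter: differentiability and
   continuity at a point of [U] are local properties. *)
Fixpoint Ck_on (R : realType) (m : nat) (W : normedModType R) (k : nat)
    (U : set 'rV[R]_m) (f : 'rV[R]_m -> W) : Prop :=
  (forall x, U x -> {for x, continuous f}) /\
  if k is k'.+1 then
    forall i : 'I_m, (forall x, U x -> derivable f x (delta_mx 0 i)) /\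
      Ck_on k' U ('D_(delta_mx 0 i) f)
  else True.

Definition smooth_on (R : realType) (m : nat) (W : normedModType R)
    (U : set 'rV[R]_m) (f : 'rV[R]_m -> W) : Prop :=
  forall k, Ck_on k U f.

Record chart (R : realType) (m : nat) (M : topologicalType) := Chart {
  chart_dom : set M;
  chart_map : M -> 'rV[R]_m;
  chart_inv : 'rV[R]_m -> M;
  chart_dom_open : open chart_dom;
  chart_im_open : open (chart_map @` chart_dom);
  chart_mapK : forall p, chart_dom p -> chart_inv (chart_map p) = p;
  chart_map_cts : {within chart_dom, continuous chart_map};
  chart_inv_cts : {within chart_map @` chart_dom, continuous chart_inv}
}.

Definition transition_smooth (R : realType) (m : nat) (M : topologicalType)
    (c d : chart R m M) : Prop :=
  smooth_on (chart_map c @` (chart_dom c `&` chart_dom d))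
    (chart_map d \o chart_inv c).

(* The atlas need not be maximal: smooth functions only depend on the maximal
   atlas it generates. *)
Record manifold (R : realType) (m : nat) := Manifold {
  carrier :> topologicalType;
  atlas : set (chart R m carrier);
  manifold_hausdorff : hausdorff_space carrier;
  manifold_second_countable : @second_countable carrier;
  atlas_cover : forall p : carrier, exists2 c, atlas c & chart_dom c p;
  atlas_smooth : forall c d, atlas c -> atlas d -> transition_smooth c d
}.

Definition smooth (R : realType) (m : nat) (M : manifold R m) (f : M -> R) :
    Prop :=
  forall c, atlas c ->
    smooth_on (chart_map c @` chart_dom c) (f \o chart_inv c).

Section SmoothClosure.
Context {R : realType} {m : nat}.
Implicit Types (U : set 'rV[R]_m) (f g : 'rV[R]_m -> R).

Lemma Ck_onW k U f : Ck_on k.+1 U f -> Ck_on k U f.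
Proof.
elim: k f => [|k IHk] f; first by case.
case=> cf df; split=> // i; have [dfi Cfi] := df i.
by split=> //; apply: IHk.
Qed.

Lemma near_eq_for_continuous U f g x : open U ->
  (forall y, U y -> f y = g y) -> U x ->
  {for x, continuous f} -> {for x, continuous g}.
Proof.
move=> oU fg Ux; rewrite /prop_for /continuous_at fg// => cf.
suff nfg : \forall y \near x, f y = g y by exact: cvg_trans (near_eq_cvg nfg) cf.
by apply: filterS (open_nbhs_nbhs (conj oU Ux)) => y /fg.
Qed.

Lemma Ck_on_eq k U f g : open U -> (forall x, U x -> f x = g x) ->
  Ck_on k U f -> Ck_on k U g.
Proof.
move=> oU; elim: k f g => [|k IHk] f g fg [cf df]; split=> //.
- by move=> x Ux; apply: (near_eq_for_continuous oU fg Ux); exact: cf.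
- by move=> x Ux; apply: (near_eq_for_continuous oU fg Ux); exact: cf.
move=> i; have [dfi Cfi] := df i; split=> [x Ux|].
  apply: near_eq_derivable (dfi x Ux).
  by apply: filterS (open_nbhs_nbhs (conj oU Ux)) => y /fg.
apply: IHk Cfi => x Ux; apply: near_eq_derive.
by apply: filterS (open_nbhs_nbhs (conj oU Ux)) => y /fg.
Qed.

Lemma Ck_on_cst k U (a : R) : open U -> Ck_on k U (fun=> a).
Proof.
move=> oU; elim: k a => [|k IHk] a; split=> //.
- by move=> x _; exact: cst_continuous.
- by move=> x _; exact: cst_continuous.
move=> i; split=> [x _|]; first exact: (derivable_cst a x).
by apply: Ck_on_eq oU _ (IHk 0) => x _; rewrite derive_cst.
Qed.

Lemma Ck_onD k U f g : open U -> Ck_on k U f -> Ck_on k U g ->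
  Ck_on k U (f + g).
Proof.
move=> oU; elim: k f g => [|k IHk] f g [cf df] [cg dg].
  by split=> // x Ux; apply: continuousD; [exact: cf|exact: cg].
split=> [x Ux|i]; first by apply: continuousD; [exact: cf|exact: cg].
have [dfi Cfi] := df i; have [dgi Cgi] := dg i.
split=> [x Ux|]; first by apply: derivableD; [exact: dfi|exact: dgi].
apply: Ck_on_eq oU _ (IHk _ _ Cfi Cgi) => x Ux.
by rewrite deriveD//; [exact: dfi|exact: dgi].
Qed.

Lemma Ck_onM k U f g : open U -> Ck_on k U f -> Ck_on k U g ->
  Ck_on k U (f * g).
Proof.
move=> oU; elim: k f g => [|k IHk] f g Cf Cg.
  case: Cf Cg => [cf _] [cg _].
  by split=> // x Ux; apply: continuousM; [exact: cf|exact: cg].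
have fk := Ck_onW Cf; have gk := Ck_onW Cg.
case: Cf Cg => [cf df] [cg dg].
split=> [x Ux|i]; first by apply: continuousM; [exact: cf|exact: cg].
have [dfi Cfi] := df i; have [dgi Cgi] := dg i.
split=> [x Ux|]; first by apply: derivableM; [exact: dfi|exact: dgi].
apply: Ck_on_eq oU _ (Ck_onD oU (IHk _ _ fk Cgi) (IHk _ _ gk Cfi)) => x Ux.
by rewrite deriveM//; [exact: dfi|exact: dgi].
Qed.

End SmoothClosure.

Section Cinf.
Context {R : realType} {m : nat} (M : manifold R m).

Section SmoothFunctions.
Implicit Types f g : M -> R.

Lemma smooth_cst (a : R) : smooth (fun _ : M => a).
Proof. by move=> c Ac k; apply: Ck_on_cst; exact: chart_im_open. Qed.

Lemma smoothD f g : smooth f -> smooth g -> smooth (f + g).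
Proof.
move=> sf sg c Ac k; apply: Ck_onD; first exact: chart_im_open.
- exact: sf.
- exact: sg.
Qed.

Lemma smoothM f g : smooth f -> smooth g -> smooth (f * g).
Proof.
move=> sf sg c Ac k; apply: Ck_onM; first exact: chart_im_open.
- exact: sf.
- exact: sg.
Qed.

Lemma smoothZ (a : R) f : smooth f -> smooth (a *: f).
Proof. by move=> sf; apply: (smoothM (smooth_cst a) sf). Qed.

Lemma smoothB f g : smooth f -> smooth g -> smooth (f - g).
Proof. by move=> sf sg; rewrite -[- g]scaleN1r; apply/smoothD/smoothZ. Qed.

End SmoothFunctions.

Definition smooth_pred : {pred M -> R} := fun f => `[< smooth f >].

Record Cinf := MkCinf { Cinf_val :> M -> R ; _ : Cinf_val \in smooth_pred }.

HB.instance Definition _ := [isSub for Cinf_val].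
HB.instance Definition _ := [Choice of Cinf by <:].

Fact smooth_subring_closed : subring_closed smooth_pred.
Proof.
split=> [|f g /asboolP sf /asboolP sg|f g /asboolP sf /asboolP sg].
- exact/asboolP/smooth_cst.
- exact/asboolP/smoothB.
- exact/asboolP/smoothM.
Qed.
HB.instance Definition _ :=
  GRing.isSubringClosed.Build (M -> R) smooth_pred smooth_subring_closed.
HB.instance Definition _ := 
  GRing.SubChoice_isSubComPzRing.Build (M -> R) smooth_pred Cinf
    smooth_subring_closed.

Fact smooth_scaler_closed : scaler_closed smooth_pred.
Proof. by move=> a f /asboolP sf; exact/asboolP/smoothZ. Qed.
HB.instance Definition _ :=
  GRing.isScaleClosed.Build R (M -> R) smooth_pred smooth_scaler_closed.
HB.instance Definition _ := [SubZmodule_isSubLmodule of Cinf by <:].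

Definition mkCinf (f : M -> R) (sf : smooth f) : Cinf := MkCinf (asboolT sf).

Lemma smoothP (f : Cinf) : smooth f.
Proof. by case: f => f /= /asboolP. Qed.

Lemma CinfP (f g : Cinf) : (forall p, f p = g p) -> f = g.
Proof. by move=> fg; apply/val_inj/funext. Qed.

(* A tangent vector at [p] is a derivation at [p] of the algebra of smooth
   functions. *)
Definition tangent_vector (p : M) : set (Cinf -> R) :=
  [set v | (forall (a : R) (f g : Cinf), v (a *: f + g) = a * v f + v g) /\
           (forall f g : Cinf, v (f * g) = v f * g p + f p * v g)].

Definition smooth_section (X : M -> Cinf -> R) : Prop :=
  (forall p, tangent_vector p (X p)) /\ (forall f, smooth (X ^~ f)).

Definition vfield_pred : {pred M -> Cinf -> R} :=
  fun X => `[< smooth_section X >].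

Record vfield := MkVfield {
  vfield_val :> M -> Cinf -> R ;
  _ : vfield_val \in vfield_pred
}.

HB.instance Definition _ := [isSub for vfield_val].
HB.instance Definition _ := [Choice of vfield by <:].

Definition mkVfield (X : M -> Cinf -> R) (sX : smooth_section X) : vfield :=
  MkVfield (asboolT sX).

Lemma vfieldP (X : vfield) : smooth_section X.
Proof. by case: X => X /= /asboolP. Qed.

Lemma vfield_eqP (X Y : vfield) : (forall p f, X p f = Y p f) -> X = Y.
Proof. by move=> XY; apply/val_inj/funext => p; apply/funext. Qed.

Fact vfield_zmod_closed : zmod_closed vfield_pred.
Proof.
split=> [|X Y /asboolP[tX sX] /asboolP[tY sY]]; apply/asboolP.
  split=> [p|f]; last exact: smooth_cst.
  by split=> [a f g|f g] /=; rewrite !(mulr0, mul0r, addr0).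
split=> [p|f]; last exact: smoothB.
have [lX dX] := tX p; have [lY dY] := tY p.
have E h : (X - Y) p h = X p h - Y p h by [].
split=> [a f g|f g]; rewrite !E.
  by rewrite lX lY mulrBr opprD addrACA.
by rewrite dX dY opprD addrACA mulrBl mulrBr.
Qed.
HB.instance Definition _ :=
  GRing.isZmodClosed.Build (M -> Cinf -> R) vfield_pred vfield_zmod_closed.
HB.instance Definition _ := [SubChoice_isSubZmodule of vfield by <:].

Fact scale_section_subproof (h : Cinf) (X : vfield) :
  smooth_section (fun p f => h p * X p f).
Proof.
have [tX sX] := vfieldP X; split=> [p|f].
  have [lX dX] := tX p; split=> [a f g|f g].
    by rewrite lX mulrDr mulrCA.
  by rewrite dX mulrDr !mulrA [h p * f p]mulrC.
exact: (smoothM (smoothP h) (sX f)).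
Qed.
Definition scale_vfield (h : Cinf) (X : vfield) : vfield :=
  mkVfield (scale_section_subproof h X).

Fact scale_vfieldA a b X :
  scale_vfield a (scale_vfield b X) = scale_vfield (a * b) X.
Proof. by apply: vfield_eqP => p f; exact: mulrA. Qed.
Fact scale_vfield1 : left_id 1 scale_vfield.
Proof. by move=> X; apply: vfield_eqP => p f; exact: mul1r. Qed.
Fact scale_vfieldDr : right_distributive scale_vfield +%R.
Proof. by move=> a X Y; apply: vfield_eqP => p f; exact: mulrDr. Qed.
Fact scale_vfieldDl X : {morph scale_vfield^~ X : a b / a + b}.
Proof. by move=> a b; apply: vfield_eqP => p f; exact: mulrDl. Qed.
HB.instance Definition _ := GRing.Zmodule_isLmodule.Build Cinf vfield
  scale_vfieldA scale_vfield1 scale_vfieldDr scale_vfieldDl.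

Definition vact (X : vfield) (f : Cinf) : Cinf := mkCinf ((vfieldP X).2 f).

Fact bracket_subproof (X Y : vfield) :
  smooth_section (fun p f => X p (vact Y f) - Y p (vact X f)).
Proof.
have [tX sX] := vfieldP X; have [tY sY] := vfieldP Y.
have vl (Z : vfield) a f g : vact Z (a *: f + g) = a *: vact Z f + vact Z g.
  by apply: CinfP => p /=; rewrite ((vfieldP Z).1 p).1.
have vd (Z : vfield) f g : vact Z (f * g) = vact Z f * g + f * vact Z g.
  by apply: CinfP => p /=; rewrite ((vfieldP Z).1 p).2.
split=> [p|f]; last by apply: smoothB; [exact: sX|exact: sY].
have [lX dX] := tX p; have [lY dY] := tY p.
have aX f g : X p (f + g) = X p f + X p g by rewrite -{1}[f]scale1r lX mul1r.
have aY f g : Y p (f + g) = Y p f + Y p g by rewrite -{1}[f]scale1r lY mul1r.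
split=> [a f g|f g].
  by rewrite !vl lX lY mulrBr opprD addrACA.
rewrite !vd aX aY !dX !dY /=.
ring.
Qed.
Definition bracket (X Y : vfield) : vfield := mkVfield (bracket_subproof X Y).

End Cinf.

(* Tensor fields are maps that are multilinear over the ring [Cinf M]; such a
   map is determined by, and determines, a smooth pointwise tensor.  Hence
   [{linear vfield M -> vfield M}] is the type of (1,1) tensor fields and
   [{scalar vfield M}] the type of 1-forms. *)

Section Geometry.
Context {R : realType} {m : nat} (M : manifold R m).
Implicit Types (X Y Z : vfield M) (f : Cinf M).
Implicit Types (g : vfield M -> vfield M -> Cinf M).
Implicit Types (nabla : vfield M -> vfield M -> vfield M).

(* The last condition is the nondegeneracy of the form induced by [g] on the
   tangent space at each [p].  The index of [g] is constant on connected
   manifolds. *)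
Record pseudo_metric g : Prop := {
  metric_linear : forall f X Y Z, g (f *: X + Y) Z = f * g X Z + g Y Z;
  metric_sym : forall X Y, g X Y = g Y X;
  metric_nondegenerate : forall (p : M) X,
    (forall Y, g X Y p = 0) -> X p = 0
}.

(* Real-linearity of [nabla X] follows from additivity and the Leibniz rule,
   since vector fields kill constant functions. *)
Record affine_connection nabla : Prop := {
  connection_linear : forall f X Y Z,
    nabla (f *: X + Y) Z = f *: nabla X Z + nabla Y Z;
  connection_additive : forall X Y Z, nabla X (Y + Z) = nabla X Y + nabla X Z;
  connection_leibniz : forall f X Y,
    nabla X (f *: Y) = vact X f *: Y + f *: nabla X Y
}.

Record levi_civita g nabla : Prop := {
  levi_civita_connection : affine_connection nabla;
  levi_civita_torsion_free : forall X Y,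
    nabla X Y - nabla Y X = bracket X Y;
  levi_civita_metric : forall X Y Z,
    vact X (g Y Z) = g (nabla X Y) Z + g Y (nabla X Z)
}.

Definition curvature nabla X Y Z : vfield M :=
  nabla X (nabla Y Z) - nabla Y (nabla X Z) - nabla (bracket X Y) Z.

Definition cov_deriv nabla X (A : vfield M -> vfield M) Y : vfield M :=
  nabla X (A Y) - A (nabla X Y).

Definition codazzi nabla (A : vfield M -> vfield M) : Prop :=
  forall X Y, cov_deriv nabla X A Y = cov_deriv nabla Y A X.

Definition lie_deriv Z g X Y : Cinf M :=
  vact Z (g X Y) - g (bracket Z X) Y - g X (bracket Z Y).

(* Normalized with the factor 1/2, which many texts omit. *)
Definition ext_deriv (eta : vfield M -> Cinf M) X Y : Cinf M :=
  (2^-1 : R) *: (vact X (eta Y) - vact Y (eta X) - eta (bracket X Y)).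

End Geometry.

Record almost_contact_pseudo_metric (R : realType) (n : nat)
    (M : manifold R n.*2.+1) (eps : R) (phi : {linear vfield M -> vfield M})
    (xi : vfield M) (eta : {scalar vfield M})
    (g : vfield M -> vfield M -> Cinf M) : Prop := {
  ac_connected : connected [set: M];
  ac_metric : pseudo_metric g;
  ac_sign : eps = 1 \/ eps = -1;
  ac_phi2 : forall X, phi (phi X) = - X + eta X *: xi;
  ac_eta_xi : eta xi = 1;
  ac_phi_xi : phi xi = 0;
  ac_eta_phi : forall X, eta (phi X) = 0;
  ac_compat : forall X Y,
    g (phi X) (phi Y) = g X Y - eps *: (eta X * eta Y)
}.

Record contact_pseudo_metric (R : realType) (n : nat)
    (M : manifold R n.*2.+1) (eps : R) (phi : {linear vfield M -> vfield M})
    (xi : vfield M) (eta : {scalar vfield M})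
    (g : vfield M -> vfield M -> Cinf M) : Prop := {
  contact_almost : almost_contact_pseudo_metric eps phi xi eta g;
  contact_form : forall X Y, ext_deriv eta X Y = g X (phi Y)
}.

(* Main.v *)
Require Import Defs.
From HB Require Import structures.
From mathcomp Require Import all_boot all_order all_algebra.
From mathcomp Require Import lra.
From mathcomp Require Import all_classical all_reals all_analysis.

Set Implicit Arguments.
Unset Strict Implicit.
Unset Printing Implicit Defensive.

Import GRing.Theory.

Local Open Scope ring_scope.

(** Write [A X := nabla X xi].  The contact condition gives the skew part of
    [A] and the definition of [tau] its symmetric part:
    [2 A = tau - 2 eps phi] ([nabla_xi]).  For a torsion-free connection
    [R(X, Y) xi = (nabla_X A) Y - (nabla_Y A) X] ([curvature_field]), so with
    [S(X, Y, Z) := g ((nabla_X tau) Y) Z] and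
    [T(X, Y, Z) := g ((nabla_X phi) Y) Z],
      [2 g (R(X, Y) xi) Z
         = S(X, Y, Z) - S(Y, X, Z) - 2 eps (T(X, Y, Z) - T(Y, X, Z))]
    ([curvature_xi]).  Here [S] is symmetric and [T] is skew in the last two
    arguments, because a covariant derivative of a (skew-)adjoint tensor is
    (skew-)adjoint ([cov_deriv_adjoint]).

    Summing cyclically, the left side vanishes by the first Bianchi identity
    and the [S] terms cancel, hence the cyclic sum of [T] is zero; this is
    closedness of the fundamental 2-form.  It turns
    [T(X, Y, Z) - T(Y, X, Z)] into [- T(Z, X, Y)].  As pair symmetry of the
    curvature turns [g (R(X, Y) xi) Z] into [g (R(xi, Z) X) Y], what remains is
      [2 g (R(xi, Z) X - eps (nabla_Z phi) X) Y = S(X, Y, Z) - S(Y, X, Z)]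
    ([curvature_codazzi_defect]).  By nondegeneracy of [g] the two sides vanish
    for all [X], [Y], [Z] together, which is the theorem. *)

(** * Vector fields as derivations *)

Section VectorFields.
Context {R : realType} {m : nat} (M : manifold R m).
Implicit Types (X Y Z : vfield M) (f h : Cinf M) (p : M).

Lemma vfield_funD X f h p : X p (f + h) = X p f + X p h.
Proof. by rewrite -{1}[f]scale1r ((vfieldP X).1 p).1 mul1r. Qed.

Lemma vfield_funZ X (a : R) f p : X p (a *: f) = a * X p f.
Proof.
have X0 : X p 0 = 0 by apply: (addrI (X p 0)); rewrite -vfield_funD !addr0.
by rewrite -[a *: f]addr0 ((vfieldP X).1 p).1 X0 addr0.
Qed.

Lemma vfield_funB X f h p : X p (f - h) = X p f - X p h.
Proof. by rewrite vfield_funD -scaleN1r vfield_funZ mulN1r. Qed.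

Lemma vact_cst X (a : R) : vact X (a *: (1 : Cinf M)) = 0.
Proof.
apply: CinfP => p; rewrite /= vfield_funZ.
have /= := ((vfieldP X).1 p).2 1 1; rewrite !mulr1 mul1r => X1.
have -> : X p 1 = 0 by lra.
exact: mulr0.
Qed.

Lemma bracketN X Y : bracket X Y = - bracket Y X.
Proof. by apply: vfield_eqP => p f; rewrite /= opprB. Qed.

Lemma jacobi X Y Z :
  bracket X (bracket Y Z) + bracket Y (bracket Z X)
    + bracket Z (bracket X Y) = 0.
Proof.
have vactE U V f : vact (bracket U V) f = vact U (vact V f) - vact V (vact U f).
  exact: CinfP.
apply: vfield_eqP => p f.
change ((bracket X (bracket Y Z)) p f + (bracket Y (bracket Z X)) p f
  + (bracket Z (bracket X Y)) p f = 0).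
rewrite /= !vactE !vfield_funB.
lra.
Qed.

End VectorFields.

(** * Curvature of a Levi-Civita connection *)

Section LeviCivita.
Context {R : realType} {m : nat} {M : manifold R m}.
Context {g : vfield M -> vfield M -> Cinf M}.
Context {nabla : vfield M -> vfield M -> vfield M}.
Hypotheses (gP : pseudo_metric g) (lc : levi_civita g nabla).
Implicit Types (X Y Z W : vfield M) (p : M).

Local Notation Rm := (curvature nabla).

Let conn := levi_civita_connection lc.

Lemma metricC X Y p : g X Y p = g Y X p.
Proof. by rewrite (Defs.metric_sym gP). Qed.

Lemma metricDl X Y Z p : g (X + Y) Z p = g X Z p + g Y Z p.
Proof. by rewrite -{1}[X]scale1r (metric_linear gP) mul1r. Qed.

Lemma metric0l Z p : g 0 Z p = 0.
Proof. by apply: (addrI (g 0 Z p)); rewrite -metricDl !addr0. Qed.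

Lemma metricZl (f : Cinf M) X Z p : g (f *: X) Z p = f p * g X Z p.
Proof.
rewrite -[f *: X]addr0 (metric_linear gP).
by change (f p * g X Z p + g 0 Z p = f p * g X Z p); rewrite metric0l addr0.
Qed.

Lemma metric_cstZ (a : R) X Z p :
  g ((a *: (1 : Cinf M)) *: X) Z p = a * g X Z p.
Proof.
rewrite metricZl; congr (_ * _).
exact: mulr1.
Qed.

Lemma metricNl X Z p : g (- X) Z p = - g X Z p.
Proof. by rewrite -scaleN1r metricZl /= mulN1r. Qed.

Lemma metricDr X Y Z p : g Z (X + Y) p = g Z X p + g Z Y p.
Proof. by rewrite metricC metricDl !(metricC Z). Qed.

Lemma metricNr X Z p : g Z (- X) p = - g Z X p.
Proof. by rewrite metricC metricNl metricC. Qed.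

Definition metricE := (metricDl, metricDr, metricNl, metricNr).

Lemma metric_inj X Y : (forall Z p, g X Z p = g Y Z p) -> X = Y.
Proof.
move=> XY; apply/eqP; rewrite -subr_eq0; apply/eqP.
apply: vfield_eqP => p f.
rewrite (metric_nondegenerate gP (p := p) (X := X - Y))// => Z.
by rewrite !metricE XY subrr.
Qed.

Lemma connectionDl X Y Z : nabla (X + Y) Z = nabla X Z + nabla Y Z.
Proof. by rewrite -{1}[X]scale1r (connection_linear conn) scale1r. Qed.

Lemma connectionNl X Z : nabla (- X) Z = - nabla X Z.
Proof.
have n0 : nabla 0 Z = 0.
  by apply: (addrI (nabla 0 Z)); rewrite -connectionDl !addr0.
by apply: (addrI (nabla X Z)); rewrite -connectionDl !subrr.
Qed.

Lemma connectionDr X Y Z : nabla X (Y + Z) = nabla X Y + nabla X Z.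
Proof. exact: connection_additive conn X Y Z. Qed.

Lemma connectionNr X Z : nabla X (- Z) = - nabla X Z.
Proof.
have n0 : nabla X 0 = 0.
  by apply: (addrI (nabla X 0)); rewrite -connectionDr !addr0.
by apply: (addrI (nabla X Z)); rewrite -connectionDr !subrr.
Qed.

Lemma connection_cstZ (a : R) X Y :
  nabla X ((a *: (1 : Cinf M)) *: Y) = (a *: (1 : Cinf M)) *: nabla X Y.
Proof. by rewrite (connection_leibniz conn) vact_cst scale0r add0r. Qed.

Lemma metric_derive X Y Z p :
  X p (g Y Z) = g (nabla X Y) Z p + g Y (nabla X Z) p.
Proof.
by have := congr1 (fun f : Cinf M => f p) (levi_civita_metric lc X Y Z).
Qed.

Lemma bracketE X Y : bracket X Y = nabla X Y - nabla Y X.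
Proof. by rewrite (levi_civita_torsion_free lc). Qed.

Lemma curvatureN X Y Z : Rm X Y Z = - Rm Y X Z.
Proof.
rewrite /curvature (bracketN X) connectionNl !opprD !opprK.
by rewrite [- nabla Y _ + _]addrC.
Qed.

(** Both sides of [[X, Y] (g Z W) = X (Y (g Z W)) - Y (X (g Z W))] are
    expanded by metric compatibility; the mixed first-order terms cancel. *)
Lemma curvature_metricN X Y Z W p : g (Rm X Y Z) W p = - g (Rm X Y W) Z p.
Proof.
have brE f : bracket X Y p f = X p (vact Y f) - Y p (vact X f) by [].
have := brE (g Z W).
rewrite !(levi_civita_metric lc) !vfield_funD !metric_derive.
rewrite /curvature !metricE !(metricC Z) => E.
lra.
Qed.

(** Torsion-freeness makes the cyclic sum of second derivatives a cyclic sum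
    of iterated brackets, so this is the Jacobi identity. *)
Lemma bianchi X Y Z : Rm X Y Z + Rm Y Z X + Rm Z X Y = 0.
Proof.
apply: metric_inj => W p; rewrite metric0l.
have := congr1 (fun V => g V W p) (jacobi X Y Z).
rewrite metric0l (bracketE X (bracket Y Z)) (bracketE Y (bracket Z X)).
rewrite (bracketE Z (bracket X Y)).
rewrite {1}(bracketE Y Z) {1}(bracketE Z X) {1}(bracketE X Y).
rewrite /curvature !connectionDr !connectionNr !metricE => E.
lra.
Qed.

(** The two skew symmetries reduce the four Bianchi identities with [W], [X],
    [Y], [Z] respectively in the last slot to relations among six values
    [a = g (R(X, Y) Z) W], [b], [c], [d = g (R(Z, W) X) Y], [e], [f]:
    [a + b + c = 0], [f = b + d], [c + d + e = 0] and [f = a + e].  The first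
    two give [a + c + f = d], the last two give [c + d + f = a]; so [a = d]. *)
Lemma curvature_pair_sym X Y Z W p : g (Rm X Y Z) W p = g (Rm Z W X) Y p.
Proof.
have bi U V A B : g (Rm U V A) B p + g (Rm V A U) B p + g (Rm A U V) B p = 0.
  by rewrite -!metricDl bianchi metric0l.
have sk1 U V A B : g (Rm U V A) B p = - g (Rm V U A) B p.
  by rewrite curvatureN metricNl.
have sk2 U V A B := curvature_metricN U V A B p.
have := bi X Y Z W; have := bi Y Z W X; have := bi Z W X Y; have := bi W X Y Z.
have := sk2 Y Z W X; have := sk2 Z W Y X; have := sk2 W X Y Z.
have := sk2 X Y W Z; have := sk1 X Z W Y; have := sk2 Z X W Y.
have := sk1 Y W X Z; have := sk2 W Y X Z.
lra.
Qed.

Lemma curvature_field X Y xi :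
  Rm X Y xi = cov_deriv nabla X (nabla^~ xi) Y
              - cov_deriv nabla Y (nabla^~ xi) X.
Proof.
rewrite /curvature /cov_deriv bracketE connectionDl connectionNl.
by rewrite !opprD !opprK addrACA.
Qed.

(** The metric is parallel, so differentiating the hypothesis along [X] only
    differentiates [A].  Used with [s = 1] for self-adjoint and [s = -1] for
    skew-adjoint [A]. *)
Lemma cov_deriv_adjoint (A : vfield M -> vfield M) (s : R) :
  (forall Y Z p, g (A Y) Z p = s * g Y (A Z) p) ->
  forall X Y Z p,
    g (cov_deriv nabla X A Y) Z p = s * g Y (cov_deriv nabla X A Z) p.
Proof.
move=> adjA X Y Z p.
have /(congr1 (X p)) : g (A Y) Z = s *: g Y (A Z) by apply: CinfP => q /=.
rewrite vfield_funZ !metric_derive /cov_deriv !metricE (adjA (nabla X Y)).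
rewrite (adjA Y (nabla X Z)) => E; lra.
Qed.

End LeviCivita.

(** * Contact structures *)

Section Contact.
Context {R : realType} {n : nat} {M : manifold R n.*2.+1} {eps : R}.
Context {phi : {linear vfield M -> vfield M}} {xi : vfield M}.
Context {eta : {scalar vfield M}} {g : vfield M -> vfield M -> Cinf M}.
Context {nabla : vfield M -> vfield M -> vfield M}.
Context {tau : {linear vfield M -> vfield M}}.
Hypotheses (cM : contact_pseudo_metric eps phi xi eta g).
Hypotheses (lc : levi_civita g nabla).
Hypotheses (tauP : forall X Y, g (tau X) Y = lie_deriv xi g X Y).
Implicit Types (X Y Z : vfield M) (p : M).

Let aM := contact_almost cM.
Let gP := ac_metric aM.

Local Notation Rm := (curvature nabla).
Local Notation T X Y Z p := (g (cov_deriv nabla X phi Y) Z p).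
Local Notation S X Y Z p := (g (cov_deriv nabla X tau Y) Z p).

Lemma sign_sqr : eps * eps = 1.
Proof. by case: (ac_sign aM) => ->; rewrite ?mulrNN mulr1. Qed.

Lemma metric_xi X : g xi X = eps *: eta X.
Proof.
apply: CinfP => p; have /(congr1 (fun f : Cinf M => f p)) := ac_compat aM xi X.
rewrite (ac_phi_xi aM) (ac_eta_xi aM) mul1r (metric0l gP) /= => /eqP.
by rewrite eq_sym subr_eq0 => /eqP.
Qed.

Lemma contact_formE X Y p :
  2 * g X (phi Y) p = X p (eta Y) - Y p (eta X) - eta (bracket X Y) p.
Proof. by rewrite -(contact_form cM) /= mulrA divff ?mul1r// pnatr_eq0. Qed.

(** Skewness of [d eta] transfers to [phi] through the contact condition. *)
Lemma phi_skew X Y p : g (phi X) Y p = -1 * g X (phi Y) p.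
Proof.
have := contact_formE X Y p; have := contact_formE Y X p.
have -> : eta (bracket Y X) p = - eta (bracket X Y) p.
  by rewrite bracketN linearN.
rewrite (metricC gP (phi X)); lra.
Qed.

(** Multiplied by [eps], the contact condition has [g xi] in place of [eta].
    Expanding by metric compatibility, the terms with [nabla X Y - nabla Y X]
    cancel against the bracket because the torsion vanishes. *)
Lemma nabla_xi_skew X Y p :
  g (nabla X xi) Y p - g (nabla Y xi) X p = 2 * eps * g X (phi Y) p.
Proof.
have := metric_derive lc X xi Y p; have := metric_derive lc Y xi X p.
rewrite !metric_xi !vfield_funZ.
have := contact_formE X Y p; rewrite (bracketE lc) linearB.
change ((eta (nabla X Y) - eta (nabla Y X)) p)
  with (eta (nabla X Y) p - eta (nabla Y X) p).
have sE Z : (eps *: eta Z) p = eps * eta Z p by [].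
rewrite !sE -mulrA mulrCA => -> E1 E2.
by rewrite !mulrBr E1 E2; lra.
Qed.

Lemma tauE X Y p : g (tau X) Y p = g (nabla X xi) Y p + g X (nabla Y xi) p.
Proof.
rewrite tauP.
change (xi p (g X Y) - g (bracket xi X) Y p - g X (bracket xi Y) p
  = g (nabla X xi) Y p + g X (nabla Y xi) p).
rewrite (metric_derive lc) !(bracketE lc) !(metricE gP).
lra.
Qed.

Lemma tau_self_adjoint X Y p : g (tau X) Y p = 1 * g X (tau Y) p.
Proof.
rewrite mul1r (metricC gP X) !tauE addrC.
by rewrite (metricC gP X) (metricC gP Y).
Qed.

Lemma nabla_xi X :
  nabla X xi + nabla X xi = tau X - ((2 * eps) *: (1 : Cinf M)) *: phi X.
Proof.
apply: (metric_inj gP) => Y p; rewrite !(metricE gP) (metric_cstZ gP).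
have := nabla_xi_skew X Y p; have := phi_skew X Y p.
rewrite tauE (metricC gP X (nabla Y xi)) => -> E; lra.
Qed.

Lemma cov_deriv_nabla_xi X Y Z p :
  2 * g (cov_deriv nabla X (nabla^~ xi) Y) Z p
    = S X Y Z p - 2 * eps * T X Y Z p.
Proof.
(* The identity 2 A = tau - 2 eps phi at Y, differentiated along X, minus
   the same identity at nabla X Y. *)
have /(congr1 (fun V => g V Z p)) := congr1 (nabla X) (nabla_xi Y).
have /(congr1 (fun V => g V Z p)) := nabla_xi (nabla X Y).
rewrite (connectionDr lc X (nabla Y xi)) (connectionDr lc X (tau Y)).
rewrite (connectionNr lc) (connection_cstZ lc).
rewrite /cov_deriv !(metricE gP) !(metric_cstZ gP); lra.
Qed.

Lemma curvature_xi X Y Z p :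
  2 * g (Rm X Y xi) Z p
    = S X Y Z p - S Y X Z p - 2 * eps * (T X Y Z p - T Y X Z p).
Proof.
have := cov_deriv_nabla_xi X Y Z p; have := cov_deriv_nabla_xi Y X Z p.
rewrite (curvature_field lc) !(metricE gP); lra.
Qed.

Lemma cov_deriv_phi_skew X Y Z p : T X Y Z p = - T X Z Y p.
Proof.
rewrite (cov_deriv_adjoint gP lc phi_skew) mulN1r.
by rewrite (metricC gP Y).
Qed.

Lemma cov_deriv_tau_sym X Y Z p : S X Y Z p = S X Z Y p.
Proof.
rewrite (cov_deriv_adjoint gP lc tau_self_adjoint) mul1r.
by rewrite (metricC gP Y).
Qed.

(** This is [d Phi = 0] for [Phi X Y = g X (phi Y)].  It is read off from the
    curvature of [xi], whose cyclic sum vanishes by [bianchi]. *)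
Lemma cov_deriv_phi_cyclic X Y Z p : T X Y Z p + T Y Z X p + T Z X Y p = 0.
Proof.
have bi : g (Rm X Y xi) Z p + g (Rm Y Z xi) X p + g (Rm Z X xi) Y p = 0.
  rewrite !(curvature_metricN gP lc _ _ xi) -!opprD.
  by rewrite -!(metricDl gP) (bianchi gP lc) (metric0l gP) oppr0.
have := curvature_xi X Y Z p; have := curvature_xi Y Z X p.
have := curvature_xi Z X Y p.
rewrite (cov_deriv_tau_sym X Z) (cov_deriv_tau_sym Y X) (cov_deriv_tau_sym Z Y).
rewrite (cov_deriv_phi_skew X Z) (cov_deriv_phi_skew Y X).
rewrite (cov_deriv_phi_skew Z Y) => E1 E2 E3.
have eT : eps * (T X Y Z p + T Y Z X p + T Z X Y p) = 0 by lra.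
by rewrite -[LHS]mul1r -sign_sqr -mulrA eT mulr0.
Qed.

Lemma curvature_codazzi_defect X Y Z p :
  2 * (g (Rm xi Z X) Y p - eps * T Z X Y p) = S X Y Z p - S Y X Z p.
Proof.
rewrite -(curvature_pair_sym gP lc).
have -> : T Z X Y p = - (T X Y Z p - T Y X Z p).
  have := cov_deriv_phi_cyclic X Y Z p.
  by rewrite (cov_deriv_phi_skew Y X); lra.
by have := curvature_xi X Y Z p; lra.
Qed.

End Contact.

Theorem lemma4p1 (R : realType) (n : nat) (M : manifold R n.*2.+1) (eps : R)
    (phi : {linear vfield M -> vfield M}) (xi : vfield M)
    (eta : {scalar vfield M}) (g : vfield M -> vfield M -> Cinf M)
    (nabla : vfield M -> vfield M -> vfield M)
    (tau : {linear vfield M -> vfield M}) :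
  contact_pseudo_metric eps phi xi eta g ->
  levi_civita g nabla ->
  (forall X Y : vfield M, g (tau X) Y = lie_deriv xi g X Y) ->
  codazzi nabla tau <->
  (forall X Y : vfield M,
    curvature nabla xi X Y = (eps *: (1 : Cinf M)) *: cov_deriv nabla X phi Y).
Proof.
move=> cM lc tauP; have gP := ac_metric (contact_almost cM).
have defect := curvature_codazzi_defect cM lc tauP.
split=> [cod X Y|curv X Y]; apply: (metric_inj gP) => Z p.
  have := defect Y Z X p.
  by rewrite (cod Y Z) (metric_cstZ gP); lra.
have := defect X Y Z p.
by rewrite curv (metric_cstZ gP); lra.
Qed.
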